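(* Let $X$ be a real normed space of algebraic dimension $\dim X=\aleph_0$ (i.e. $X$ has a countably infinite Hamel basis). Then $X$ has a star-finite covering by closed balls.
   Context: Closed balls have positive radius. A covering of $X$ is a family of nonempty subsets of $X$ whose union is $X$. A family of sets is star-finite if each of its members intersects only finitely many other members. *)

(* Defs.v *)
From HB Require Import structures.
From mathcomp Require Import all_boot all_order all_algebra.
From mathcomp Require Import boolp classical_sets functions cardinality reals.
From mathcomp Require Import topology normedtype.

Set Implicit Arguments.
Unset Strict Implicit.
Unset Printing Implicit Defensive.
Import Order.TTheory GRing.Theory Num.Theory.
Import numFieldNormedType.Exports.
Local Open Scope classical_set_scope.
Local Open Scope ring_scope.

Definition linearly_independent (K : fieldType) (V : lmodType K) (B : set V) :=
  forall (s : seq V) (a : V -> K), uniq s -> [set` s] `<=` B ->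
    \sum_(v <- s) a v *: v = 0 -> forall v, v \in s -> a v = 0.

Definition spanning (K : fieldType) (V : lmodType K) (B : set V) :=
  forall x : V, exists (s : seq V) (a : V -> K),
    [set` s] `<=` B /\ x = \sum_(v <- s) a v *: v.

Definition hamel_basis (K : fieldType) (V : lmodType K) (B : set V) :=
  linearly_independent B /\ spanning B.

Definition has_dim_aleph0 (K : fieldType) (V : lmodType K) :=
  exists B : set V, hamel_basis B /\ (B #= [set: nat])%card.

Definition covering (T : Type) (F : set (set T)) :=
  (forall A, F A -> A !=set0) /\ \bigcup_(A in F) A = [set: T].

Definition star_finite (T : Type) (F : set (set T)) :=
  forall A, F A -> finite_set [set B | [/\ F B, B <> A & A `&` B !=set0]].

(* The library's [closed_ball c r] is the closure of the open ball; for [0 < r]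
   in a normed module it is [{y | `|c - y| <= r}] ([closed_ballE]). *)
Definition is_closed_ball (R : realType) (X : normedModType R) (A : set X) :=
  exists (c : X) (r : R), 0 < r /\ A = closed_ball c r.

(* Main.v *)
Require Import Defs.
From mathcomp Require Import all_boot all_order all_algebra.
From mathcomp Require Import boolp classical_sets functions cardinality reals.
From mathcomp Require Import topology normedtype.
From mathcomp Require Import finmap lra.
Import Order.TTheory GRing.Theory Num.Theory.
Import numFieldNormedType.Exports.
Local Open Scope classical_set_scope.
Local Open Scope ring_scope.

(** A normed space with a countable spanning set is a countable union of compact
sets [K n]: finite sums of segments on the lines through the spanning vectors.
Star-finiteness is weaker than local finiteness: balls may accumulate at the
boundary of another ball without meeting it, as the intervals [1/(n+2), 1/(n+1)]
accumulate at the right end of [-1, 0].  So a ball, once chosen, need not be met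
by any ball chosen later, and an inductive construction is possible.

The induction keeps a nonempty closed union [C] of balls already chosen, starting
with one ball.  Given the next compact set [K], the part of [K] outside [C] is
covered as in a Whitney decomposition, by balls with centers [c] in [K] and radius
[dist C c / 4].
- Such balls are disjoint from [C], so families chosen at different steps do not
  meet.
- By compactness of [K] the centers can be chosen so that only finitely many are
  at distance at least [e] from [C], for each [e > 0]
  ([locally_finite_centers]).  Balls that meet have comparable radii, so the new
  family is star-finite.
- Near a point outside [C] only finitely many of the new balls occur, so the union
  of [C] with the new balls is closed again ([extend_closed_cover]) and the
  construction goes on with the next compact set
  ([sigma_compact_star_finite]). *)

(** * Distance to a set *)

Definition dist {R : realType} {X : normedModType R} (C : set X) (x : X) : R :=
  inf [set `|x - c| | c in C].

Lemma dist_le {R : realType} {X : normedModType R} {C : set X} (x c : X) :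
  C c -> dist C x <= `|x - c|.
Proof.
by move=> Cc; apply: ge_inf; [exists 0 => _ [y _ <-]; exact: normr_ge0|exists c].
Qed.

Lemma le_dist {R : realType} {X : normedModType R} {C : set X} (x : X) (r : R) :
  C !=set0 -> (forall c, C c -> r <= `|x - c|) -> r <= dist C x.
Proof.
move=> [c Cc] rC; apply: lb_le_inf => [|_ [c' Cc' <-]]; last exact: rC.
by exists `|x - c|, c.
Qed.

Lemma dist_lipschitz {R : realType} {X : normedModType R} {C : set X} (x y : X) :
  C !=set0 -> dist C x <= dist C y + `|x - y|.
Proof.
move=> C0; rewrite -lerBlDr; apply: le_dist => // c Cc.
by rewrite lerBlDr; apply: (le_trans (dist_le x c Cc)); rewrite [leRHS]addrC ler_distD.
Qed.

Lemma dist_continuous {R : realType} {X : normedModType R} {C : set X} :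
  C !=set0 -> continuous (dist C).
Proof.
move=> C0 x; apply/cvgrPdist_lt => e e0; near=> y.
have xy : `|x - y| < e by near: y; exact: cvgr_dist_lt.
have := dist_lipschitz x y C0; have := dist_lipschitz y x C0.
rewrite (distrC y x) => h1 h2.
by rewrite ltr_norml; apply/andP; split; lra.
Unshelve. all: by end_near. Qed.

Lemma dist_gt0 {R : realType} {X : normedModType R} {C : set X} (x : X) :
  C !=set0 -> closed C -> ~ C x -> 0 < dist C x.
Proof.
move=> C0 Ccl Cx.
have : nbhs x (~` C) by apply: open_nbhs_nbhs; split => //; exact: closed_openC.
move=> /nbhs_ballP[e /= e0 eC]; apply: (lt_le_trans e0); apply: le_dist => // c Cc.
by rewrite leNgt; apply/negP => ce; apply: (eC c) Cc; rewrite -ball_normE.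
Qed.

(** * Covering a compact set up to a closed set *)

(** The set of points of [K] where [d > 0] is not compact, but it is the union of the
compact shells on which [d] lies between [1 / (j + 1)] and [1 / j].  Finitely many
balls suffice for each shell, and a lower bound on [d] leaves only finitely many
shells. *)
Lemma locally_finite_centers {R : realType} {X : normedModType R} (K : set X)
    (d : X -> R) : compact K -> continuous d ->
  exists S : set X, [/\ S `<=` [set c | 0 < d c],
    forall x, K x -> 0 < d x -> exists2 c, S c & `|c - x| <= d c / 4 &
    forall e, 0 < e -> finite_set [set c | S c /\ e <= d c]].
Proof.
move=> Kc dc.
(* Multiplied out, the bounds make sense for [j = 0], where the upper one is void. *)
pose shell j := K `&` [set x | j%:R * d x <= 1 /\ 1 <= j.+1%:R * d x].
have shell_gt0 j c : shell j c -> 0 < d c.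
  move=> [_ [_ h]]; have : 0 < j.+1%:R * d c by lra.
  by rewrite pmulr_rgt0.
have shellc j : compact (shell j).
  apply: compact_closedI => //; apply: closedI.
    apply: (@closed_comp _ _ (fun x => j%:R * d x) [set r | r <= 1]); last exact: closed_le.
    by move=> x _; apply: cvgM; [exact: cvg_cst|exact: dc].
  apply: (@closed_comp _ _ (fun x => j.+1%:R * d x) [set r | 1 <= r]); last exact: closed_ge.
  by move=> x _; apply: cvgM; [exact: cvg_cst|exact: dc].
have : forall j, exists S : set X, [/\ finite_set S, S `<=` shell j &
    forall x, shell j x -> exists2 c, S c & `|c - x| <= d c / 4].
  move=> j; have := shellc j; rewrite compact_cover.
  case/(_ X (shell j) (fun c => ball c (d c / 4))).
  - by move=> c cj; apply: ball_open; rewrite divr_gt0 // (shell_gt0 j).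
  - move=> x xj; exists x => //; apply: ballxx.
    by rewrite divr_gt0 // (shell_gt0 j).
  move=> D Dj Dcov; exists [set` D]; split.
  - exact: finite_fset.
  - by move=> c /Dj /set_mem.
  - move=> x /Dcov[c cD cx]; exists c => //.
    by move: cx; rewrite -ball_normE => /ltW.
move=> /choice[S HS]; exists (\bigcup_j S j); split.
- by move=> c [j _ Sc]; apply: (shell_gt0 j); have [_ + _] := HS j; exact.
- move=> x Kx dx.
  pose j := Num.truncn (d x)^-1.
  have /andP[j1 j2] : j%:R <= (d x)^-1 < j.+1%:R by apply: truncn_itv; rewrite invr_ge0 ltW.
  have xj : shell j x.
    split => //; split.
      by rewrite -ler_pdivlMr // mul1r.
    by rewrite -ler_pdivrMr // mul1r ltW.
  have [_ _ /(_ x xj)[c Sc cx]] := HS j; exists c => //; by exists j.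
- move=> e e0.
  apply: (@sub_finite_set _ _ (\bigcup_(j in `I_(Num.truncn e^-1).+1) S j)); last first.
    by apply: bigcup_finite => // j _; have [] := HS j.
  move=> c [[j _ Sjc] ec]; exists j => //=.
  have [_ /(_ c Sjc)[_ [jc _]] _] := HS j.
  rewrite ltnS truncn_ge_nat ?invr_ge0 ?(ltW e0) // -[e^-1]mul1r ler_pdivlMr //.
  by apply: le_trans jc; rewrite ler_wpM2l.
Qed.

(** The step of the construction; the last conclusion is what allows it to be
repeated. *)
Lemma extend_closed_cover {R : realType} {X : normedModType R} (C K : set X) :
  closed C -> C !=set0 -> compact K ->
  exists F : set (set X), [/\ star_finite F, forall A, F A -> is_closed_ball A,
    forall A, F A -> A `&` C = set0, K `<=` C `|` \bigcup_(A in F) A &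
    closed (C `|` \bigcup_(A in F) A)].
Proof.
move=> Ccl C0 Kc; pose d := dist C.
have [S [Spos Scov Sfin]] := locally_finite_centers K d Kc (dist_continuous C0).
pose B c := closed_ball c (d c / 4).
have Br c : S c -> 0 < d c / 4 by move=> /Spos dc; rewrite divr_gt0.
have BP c x : S c -> B c x <-> `|c - x| <= d c / 4.
  by move=> Sc; rewrite /B closed_ballE ?Br.
(* [dist C] is 1-Lipschitz, hence within a quarter of [d c] of [d c] on [B c]. *)
have dB c x : S c -> B c x -> d x <= 5 / 4 * d c /\ 3 / 4 * d c <= d x.
  move=> Sc /BP -/(_ Sc) cx.
  have := dist_lipschitz x c C0; have := dist_lipschitz c x C0.
  rewrite -/(d c) -/(d x) (distrC x c); split; lra.
exists (B @` S); split.
- move=> _ [c Sc <-].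
  (* At a common point [x] of two balls, 3/4 d(c) <= d(x) <= 5/4 d(a). *)
  apply: (@sub_finite_set _ _ (B @` [set a | S a /\ 3 / 5 * d c <= d a])).
    move=> _ [[a Sa <-] _ [x [cx ax]]]; exists a => //; split => //.
    have [_ ?] := dB _ _ Sc cx; have [? _] := dB _ _ Sa ax; lra.
  by apply: finite_image; apply: Sfin; have := Spos c Sc; rewrite /=; lra.
- by move=> _ [c Sc <-]; exists c, (d c / 4); split => //; exact: Br.
- move=> _ [c Sc <-]; apply/seteqP; split => // x [/BP -/(_ Sc) cx Cx].
  by have := dist_le c x Cx; have := Spos c Sc; rewrite /= -/(d c); lra.
- move=> x Kx; have [Cx|Cx] := pselect (C x); [by left|right].
  have [c Sc cx] := Scov x Kx (dist_gt0 x C0 Ccl Cx).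
  by exists (B c); [exists c|apply/BP].
- rewrite -openC openE => x /not_orP[Cx Fx]; rewrite /interior.
  have dx : 0 < d x := dist_gt0 x C0 Ccl Cx.
  (* A ball [B c] containing some [y] with [d y > d x / 2] has 5/4 d(c) > d(x) / 2,
     so its center is in the finite set [S']. *)
  pose S' := [set c | S c /\ 2 / 5 * d x <= d c].
  have S'cl : closed (C `|` \bigcup_(c in S') B c).
    apply: closedU => //; apply: closed_bigcup => [|c _]; last exact: closed_ball_closed.
    by apply: Sfin; lra.
  have S'x : ~ (C `|` \bigcup_(c in S') B c) x.
    by move=> [//|[c [Sc _] cx]]; apply: Fx; exists (B c) => //; exists c.
  have : nbhs x (~` (C `|` \bigcup_(c in S') B c)).
    by apply: open_nbhs_nbhs; split => //; exact: closed_openC.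
  have : nbhs x [set y | d x / 2 < d y].
    apply: (dist_continuous C0 x [set r | d x / 2 < r]).
    by apply: open_nbhs_nbhs; split; [exact: open_gt|rewrite /= -/(d x); lra].
  apply: filterS2 => y /= xy S'y [Cy|[_ [c Sc <-] cy]]; apply: S'y; first by left.
  right; exists c => //; split => //; have [? _] := dB _ _ Sc cy; lra.
Qed.

(** * Star-finite coverings of sigma-compact normed spaces *)

Lemma sigma_compact_star_finite {R : realType} {X : normedModType R}
    (K : nat -> set X) :
  (forall n, compact (K n)) -> \bigcup_n K n = [set: X] ->
  exists F : set (set X),
    [/\ covering F, star_finite F & forall A, F A -> is_closed_ball A].
Proof.
move=> Kc KT.
(* The pair [p] is the closed set reached and the index of the next compact set. *)
have /choice[G GP] : forall p : set X * nat, exists F : set (set X),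
    closed p.1 -> p.1 !=set0 ->
    [/\ star_finite F, forall A, F A -> is_closed_ball A,
      forall A, F A -> A `&` p.1 = set0, K p.2 `<=` p.1 `|` \bigcup_(A in F) A &
      closed (p.1 `|` \bigcup_(A in F) A)].
  move=> [C n]; have [[Ccl C0]|nC] := pselect (closed C /\ C !=set0).
    by have [F ?] := extend_closed_cover C (K n) Ccl C0 (Kc n); exists F.
  by exists set0 => ? ?; case: nC.
pose B0 : set X := closed_ball 0 1.
pose C := fix C n := if n is m.+1 then C m `|` \bigcup_(A in G (C m, m)) A else B0.
pose F n := G (C n, n).
have CP n : closed (C n) /\ C n !=set0.
  elim: n => [|n [Ccl Cn0]] /=.
    by split; [exact: closed_ball_closed|exists 0; exact: closed_ballxx].
  have [_ _ _ _ ?] := GP (C n, n) Ccl Cn0; split => //.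
  by case: Cn0 => x Cx; exists x; left.
have FP n : [/\ star_finite (F n), forall A, F n A -> is_closed_ball A,
    forall A, F n A -> A `&` C n = set0 &
    K n `<=` C n `|` \bigcup_(A in F n) A].
  by have [Ccl Cn0] := CP n; have [] := GP (C n, n) Ccl Cn0.
have Cmono m n : (m <= n)%N -> C m `<=` C n.
  elim: n => [|n IH]; first by rewrite leqn0 => /eqP ->.
  rewrite leq_eqVlt => /predU1P[->//|]; rewrite ltnS => /IH mn x /mn ?; by left.
have FC n A : F n A -> A `<=` C n.+1 by move=> FA x Ax; right; exists A.
have meetF m n A B : (m < n)%N -> F m A -> F n B -> ~ (A `&` B !=set0).
  move=> mn FA FB [x [Ax Bx]].
  have [_ _ /(_ _ FB) disj _] := FP n.
  by suff : set0 x by []; rewrite -disj; split => //; apply: (Cmono _ _ mn); apply: (FC m A).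
have meetF0 n A : F n A -> ~ (A `&` B0 !=set0).
  move=> FA [x [Ax B0x]]; have [_ _ /(_ _ FA) disj _] := FP n.
  by suff : set0 x by []; rewrite -disj; split => //; apply: (Cmono 0 n).
have meetE n A B : F n A -> (B = B0 \/ exists m, F m B) -> A `&` B !=set0 -> F n B.
  move=> FA [->|[m FB]] AB; first by case: (meetF0 _ _ FA).
  have [mn|nm|<-//] := ltngtP m n.
    by case: (meetF _ _ _ _ mn FB FA); rewrite setIC.
  by case: (meetF _ _ _ _ nm FA FB).
have ballF A : (A = B0 \/ exists n, F n A) -> is_closed_ball A.
  by move=> [->|[n FA]]; [exists 0, 1|have [_ + _ _] := FP n; exact].
exists [set A | A = B0 \/ exists n, F n A]; split => //; first split.
- by move=> A /ballF[c [r [r0 ->]]]; exists c; exact: closed_ballxx.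
- have CF n x : C n x -> exists2 A, (A = B0 \/ exists n, F n A) & A x.
    elim: n => [B0x|n IH /= [/IH//|[A FA Ax]]]; first by exists B0 => //; left.
    by exists A => //; right; exists n.
  apply/seteqP; split => // x _; have : (\bigcup_n K n) x by rewrite KT.
  move=> [n _ Kx]; have [_ _ _ /(_ x Kx) cov] := FP n.
  by apply: (CF n.+1).
- move=> A [->|[n FA]].
    apply: (@sub_finite_set _ _ set0) => // B [[//|[n FB]] _ ].
    by rewrite setIC => /(meetF0 _ _ FB).
  have [/(_ A FA) fin _ _ _] := FP n; apply: sub_finite_set fin.
  by move=> B [FB BA AB]; split => //; exact: meetE AB.
Qed.

(** * Sigma-compactness of countably generated normed spaces *)

(** Indexing by lists [t] of pairs (vector, bound on its coefficient), repetitions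
allowed, turns an arbitrary linear combination into a list by adding one pair per
term; such lists can be enumerated. *)
Lemma countable_span_sigma_compact {R : realType} {X : normedModType R}
    (e : nat -> X) : spanning (range e) ->
  exists K : nat -> set X,
    (forall n, compact (K n)) /\ \bigcup_n K n = [set: X].
Proof.
move=> espan.
pose seg (p : nat * nat) : set X := (fun a : R => a *: e p.1) @` `[- p.2%:R, p.2%:R].
pose add (A B : set X) := (fun x : X * X => x.1 + x.2) @` (A `*` B).
pose Q (t : seq (nat * nat)) := foldr (fun p A => add (seg p) A) [set 0] t.
have Qc t : compact (Q t).
  elim: t => [|p t IH] /=; first exact: compact_set1.
  apply: continuous_compact; first by apply: continuous_subspaceT => x; exact: add_continuous.
  apply: compact_setX => //; apply: continuous_compact; last exact: segment_compact.
  by apply: continuous_subspaceT => x; exact: scalel_continuous.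
exists (fun n => if choice.unpickle n is Some t then Q t else set0); split.
  by move=> n; case: (choice.unpickle n) => [t|]; [exact: Qc|exact: compact0].
apply/seteqP; split => // x _.
suff [t Qt] : exists t, Q t x by exists (choice.pickle t) => //; rewrite choice.pickleK.
have [s [a [sB ->]]] := espan x.
elim: s sB {x} => [|v s IH] sB; first by exists [::]; rewrite big_nil.
have [|t Qt] := IH; first by move=> w ws; apply: sB; rewrite /= inE; apply/orP; right.
have [i _ iv] : range e v by apply: sB; rewrite /= mem_head.
exists ((i, (Num.truncn `|a v|).+1) :: t); rewrite big_cons.
exists (a v *: v, \sum_(w <- s) a w *: w) => //; split => //=.
exists (a v); last by rewrite iv.
rewrite /= in_itv /= -ler_norml; exact/ltW/truncnS_gt.
Qed.

Theorem theorem2p12 (R : realType) (X : normedModType R)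
    (dimX : has_dim_aleph0 X) :
  exists F : set (set X),
    [/\ covering F, star_finite F & forall A, F A -> is_closed_ball A].
Proof.
have [B [[_ spanB] /card_esym/pcard_eqP/bijPex[e [_ _ surj]]]] := dimX.
have [|K [Kc KT]] := countable_span_sigma_compact e.
  move=> x; have [s [a [sB ->]]] := spanB x; exists s, a; split => //.
  by move=> v /sB /surj[n _ <-]; exists n.
exact: sigma_compact_star_finite Kc KT.
Qed.
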